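(* Let $\Sigma$ be a finite set of atoms and let $T$ be a propositional theory over $\Sigma$. Let $$F(T) := \bigvee_{(X,Y)\,:\,(X,Y)\models T} c_{X,Y},$$ where the disjunction ranges over all here-and-there interpretations $(X,Y)$ over $\Sigma$ that are models of $T$. Then $T$ is equivalent to $F(T)$ in the logic of here-and-there, i.e. $T$ and $F(T)$ have the same here-and-there models.
   Context: Propositional formulas over $\Sigma$ are built from atoms with $\bot,\vee,\wedge,\to$; $\neg F := F\to\bot$ and $\top:=\bot\to\bot$; a theory is a (possibly infinite) set of formulas. A classical interpretation is a set $Y\subseteq\Sigma$ of true atoms; $Y\models F$ is classical satisfaction. A here-and-there (HT) interpretation is a pair $(X,Y)$ with $X\subseteq Y\subseteq\Sigma$. Satisfaction: $(X,Y)\models a$ iff $a\in X$ for an atom $a$; $(X,Y)\not\models\bot$; $(X,Y)\models F\wedge G$ iff $(X,Y)\models F$ and $(X,Y)\models G$; $(X,Y)\models F\vee G$ iff $(X,Y)\models F$ or $(X,Y)\models G$; $(X,Y)\models F\to G$ iff both ($(X,Y)\models F$ implies $(X,Y)\models G$) and $Y\models F\to G$ classically. $(X,Y)\models T$ ($(X,Y)$ is a model of $T$) means that $(X,Y)$ satisfies every formula of $T$. For an HT interpretation $(X,Y)$ over $\Sigma$, $c_{X,Y}$ is the formula $$\Big(\bigwedge_{a\in X} a\Big)\wedge\Big(\bigwedge_{b\in\Sigma\setminus Y}\neg b\Big)\wedge\Big(\bigwedge_{c\in Y\setminus X}\neg\neg c\Big)\wedge\bigwedge_{d,e\in Y\setminus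 X}(d\to e).$$ Empty conjunctions are $\top$ and empty disjunctions are $\bot$. *)

(* Defs.v *)
From mathcomp Require Import all_boot.
From mathcomp Require Import boolp classical_sets.

Set Implicit Arguments.
Unset Strict Implicit.
Unset Printing Implicit Defensive.

Inductive form (Sigma : Type) : Type :=
| FAtom of Sigma
| FBot
| FOr of form Sigma & form Sigma
| FAnd of form Sigma & form Sigma
| FImp of form Sigma & form Sigma.

Arguments FBot {Sigma}.

Definition FNeg (Sigma : Type) (F : form Sigma) : form Sigma := FImp F FBot.

Definition FTop {Sigma : Type} : form Sigma := FImp FBot FBot.

Definition theory (Sigma : Type) : Type := set (form Sigma).

Fixpoint cl_sat (Sigma : finType) (Y : {set Sigma}) (F : form Sigma) : bool :=
  match F with
  | FAtom a => a \in Y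
  | FBot => false
  | FOr G H => cl_sat Y G || cl_sat Y H
  | FAnd G H => cl_sat Y G && cl_sat Y H
  | FImp G H => cl_sat Y G ==> cl_sat Y H
  end.

Definition ht_interp (Sigma : finType) : Type :=
  {I : {set Sigma} * {set Sigma} | I.1 \subset I.2}.

Definition here (Sigma : finType) (I : ht_interp Sigma) : {set Sigma} :=
  (val I).1.

Definition there (Sigma : finType) (I : ht_interp Sigma) : {set Sigma} :=
  (val I).2.

Fixpoint ht_sat (Sigma : finType) (I : ht_interp Sigma) (F : form Sigma) :
    bool :=
  match F with
  | FAtom a => a \in here I
  | FBot => false
  | FOr G H => ht_sat I G || ht_sat I H
  | FAnd G H => ht_sat I G && ht_sat I H
  | FImp G H => (ht_sat I G ==> ht_sat I H) && cl_sat (there I) (FImp G H)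
  end.

Definition ht_model (Sigma : finType) (I : ht_interp Sigma)
    (T : theory Sigma) : Prop :=
  forall F : form Sigma, T F -> ht_sat I F.

Definition ht_equiv (Sigma : finType) (T1 T2 : theory Sigma) : Prop :=
  forall I : ht_interp Sigma, ht_model I T1 <-> ht_model I T2.

(* Here and in [disj_models], a finite conjunction (disjunction) is nested to
   the right in the order of the enumeration of its index type and ends with
   [FTop] (resp. [FBot]). *)
Definition char_form (Sigma : finType) (I : ht_interp Sigma) : form Sigma :=
  let X := here I in
  let Y := there I in
  FAnd (FAnd (FAnd
    (\big[@FAnd Sigma/FTop]_(a in X) FAtom a)
    (\big[@FAnd Sigma/FTop]_(b in ~: Y) FNeg (FAtom b)))
    (\big[@FAnd Sigma/FTop]_(c in Y :\: X) FNeg (FNeg (FAtom c))))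
    (\big[@FAnd Sigma/FTop]_(
       de : Sigma * Sigma | (de.1 \in Y :\: X) && (de.2 \in Y :\: X))
         FImp (FAtom de.1) (FAtom de.2)).

(* Being a model of an arbitrary theory is not decidable, so the models that
   index the disjunction are selected by classical choice, via [asbool]. *)
Definition disj_models (Sigma : finType) (T : theory Sigma) : form Sigma :=
  \big[@FOr Sigma/FBot]_(I : ht_interp Sigma | `[< ht_model I T >]) char_form I.

(* Main.v *)
(** An HT interpretation (X', Y') satisfies c_{X,Y} exactly when Y' = Y and X'
    is X or Y: the first three conjuncts force Y' = Y and X to be a subset of
    X', and the implications d -> e force X' to contain all or nothing of
    Y \ X. Both (X, Y) and (Y, Y) are models of T whenever (X, Y) is, by
    persistence, so the disjunction adds no new models. *)

Require Import Defs.
From mathcomp Require Import all_boot.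
From mathcomp Require Import boolp classical_sets.

Lemma here_sub_there {Sigma : finType} (I : ht_interp Sigma) :
  here I \subset there I.
Proof. exact: (valP I). Qed.

(** Persistence, by induction on [F]: atoms use [here I \subset there I], and the clause for [FImp]
    contains the classical condition outright. *)
Lemma ht_sat_cl_sat {Sigma : finType} {I : ht_interp Sigma} {F : form Sigma} :
  ht_sat I F -> cl_sat (there I) F.
Proof.
elim: F => [a|//|G IHG H IHH|G IHG H IHH|G _ H _] /=.
- exact: (fintype.subsetP (here_sub_there I)).
- by case/orP=> [/IHG ->|/IHH ->]; rewrite ?orbT.
- by case/andP=> /IHG -> /IHH ->.
- by case/andP.
Qed.

(** When both worlds coincide, the two halves of the clause for [FImp] become the same condition. *)
Lemma ht_sat_total {Sigma : finType} {I : ht_interp Sigma} {F : form Sigma} :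
  here I = there I -> ht_sat I F = cl_sat (there I) F.
Proof.
move=> eqXY; elim: F => [a|//|G IHG H IHH|G IHG H IHH|G IHG H IHH] /=.
- by rewrite eqXY.
- by rewrite IHG IHH.
- by rewrite IHG IHH.
- by rewrite IHG IHH andbb.
Qed.

Lemma ht_sat_big_and {Sigma J : finType} (I : ht_interp Sigma) (P : pred J)
    (F : J -> form Sigma) :
  ht_sat I (\big[@FAnd Sigma/FTop]_(j | P j) F j) =
  [forall (j | P j), ht_sat I (F j)].
Proof.
by rewrite (big_morph (ht_sat I) (id1 := true) (op1 := andb)) ?big_andE.
Qed.

Lemma ht_sat_big_or {Sigma J : finType} (I : ht_interp Sigma) (P : pred J)
    (F : J -> form Sigma) :
  ht_sat I (\big[@FOr Sigma/FBot]_(j | P j) F j) =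
  [exists (j | P j), ht_sat I (F j)].
Proof.
by rewrite (big_morph (ht_sat I) (id1 := false) (op1 := orb)) ?big_orE.
Qed.

(** By persistence, a formula refuted in the there-world is also refuted in the here-world, so
    negation is settled classically. *)
Lemma ht_sat_neg {Sigma : finType} (I : ht_interp Sigma) (F : form Sigma) :
  ht_sat I (FNeg F) = ~~ cl_sat (there I) F.
Proof.
rewrite /= !implybF andb_idl //; apply: contra; exact: ht_sat_cl_sat.
Qed.

Lemma char_formP {Sigma : finType} {I J : ht_interp Sigma} :
  reflect (there I = there J /\ (here I = here J \/ here I = there I))
          (ht_sat I (char_form J)).
Proof.
have sI := here_sub_there I; have sJ := here_sub_there J.
rewrite /char_form /= !ht_sat_big_and.
apply: (iffP idP) => [|[eqY eqX]]; last first.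
  have sJI : here J \subset here I by case: eqX => ->; rewrite ?eqY.
  rewrite -!andbA; apply/and4P; split; apply/forall_inP.
  - exact: (fintype.subsetP sJI).
  - by move=> b; rewrite ht_sat_neg inE eqY.
  - by move=> c; rewrite ht_sat_neg /= implybF negbK inE eqY => /andP[].
  - case=> d e /= /andP[]; rewrite !inE => /andP[dX dY] /andP[_ eY].
    rewrite eqY eY implybT andbT.
    (* If [here I = here J], the premise [d] fails; if [here I = there I], the conclusion [e]
       holds. *)
    by case: eqX => ->; rewrite ?(negbTE dX) // eqY eY implybT.
case/andP=> /andP[/andP[/forall_inP hX /forall_inP hNY] /forall_inP hNN].
move=> /forall_inP hde.
have sX : here J \subset here I by apply/fintype.subsetP.
have eqY : there I = there J.
  apply/eqP; rewrite finset.eqEsubset; apply/andP; split; apply/fintype.subsetP => a aY.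
    by apply: contraLR aY => aY; rewrite -(ht_sat_neg I (FAtom a)) hNY ?inE.
  (* An atom of [here J] is already in [here I]; for any other atom of [there J], the double
     negation forces it into [there I]. *)
  have [aX|aX] := boolP (a \in here J).
    exact: (fintype.subsetP sI) (fintype.subsetP sX a aX).
  by have := hNN a; rewrite ht_sat_neg /= implybF negbK inE aX => ->.
split=> //.
(* A single atom [d] of [here I] outside [here J] triggers every implication from [d] to [e], which
   fills [here I] up to [there I]. *)
have [sXJ|/fintype.subsetPn[d dI dJ]] := boolP (here I \subset here J).
  by left; apply/eqP; rewrite finset.eqEsubset sXJ.
right; apply/eqP; rewrite finset.eqEsubset sI; apply/fintype.subsetP => e eY.
have [eJ|eJ] := boolP (e \in here J); first exact: (fintype.subsetP sX).
have := hde (d, e); rewrite /= !inE dJ eJ -eqY eY (fintype.subsetP sI) //= dI.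
by case/(_ isT)/andP.
Qed.

Theorem theorem4 (Sigma : finType) (T : theory Sigma) :
  ht_equiv T [set disj_models T]%classic.
Proof.
move=> I; split=> [IT _ ->|/(_ _ erefl)]; rewrite /disj_models ht_sat_big_or.
  apply/exists_inP; exists I; first exact/asboolP.
  by apply/char_formP; split; last left.
case/exists_inP=> J /asboolP JT /char_formP[eqY [eqX|totI]] F TF.
  suff -> : I = J by exact: JT.
  apply: val_inj; rewrite [LHS]surjective_pairing [RHS]surjective_pairing.
  by congr pair.
(* Here [I] is total, so classical truth in [there J] suffices; it follows by persistence from [J]
   being a model of [T]. *)
by rewrite ht_sat_total // eqY ht_sat_cl_sat // JT.
Qed.
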